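(* Let $f:A\to B$ and $p:B\to C$ be group homomorphisms, let $q=p\cdot f$, and regard $f$ as a morphism $f:q\to p$ in the slice category $\mathsf{Grp}/C$. Then the normal closure $\nu_{f/C}$ of $f$ in $\mathsf{Grp}/C$ is given by the subgroup inclusion $$N_{f/C}=\mathrm{Im}(f)\,\widehat{E}^B\hookrightarrow B,$$ where $\widehat{E}^B$ denotes the least normal subgroup of $B$ containing $E=\mathrm{Ker}(p)\cap\mathrm{Im}(f)$. It coincides with the normal closure $\nu_f$ of $f$ in $\mathsf{Grp}$ if $\mathrm{Im}(f)\subseteq\mathrm{Ker}(p)$.
   Context: $\mathsf{Grp}$ is the category of groups. The slice $\mathsf{Grp}/C$ has as objects the homomorphisms with codomain $C$; a morphism $f:q\to p$ is a homomorphism $f$ with $p\cdot f=q$. In a finitely complete and finitely cocomplete category with terminal object $1$, the normal closure of a morphism $f:A\to B$ is the pullback projection $\nu_f:N_f=B\times_{(B+_A1)}1\to B$, where $B+_A1$ is the pushout of $f$ along $A\to1$ and the pullback is formed of the two pushout injections $B\to B+_A1\leftarrow 1$; it is determined up to isomorphism over $B$. In $\mathsf{Grp}$, $\nu_f$ is the inclusion into $B$ of the least normal subgroup of $B$ containing $\mathrm{Im}(f)$. Applied in the slice $\mathsf{Grp}/C$ (with terminal object $1_C$) to $f:q\to p$, the definition amounts to forming in $\mathsf{Grp}$ the pushout $B+_AC$ of $f$ along $q=p\cdot f$ and then the pullback $N_{f/C}$ of the pushout injections $B\to B+_AC\leftarrow C$; its projection $N_{f/C}\to B$ is (the underlying morphism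 of) the normal closure $\nu_{f/C}$ of $f$ in $\mathsf{Grp}/C$. *)

(* Defs.v *)
From HB Require Import structures.
From mathcomp Require Import all_boot.
From mathcomp Require Import boolp classical_sets.

Set Implicit Arguments.
Unset Strict Implicit.
Unset Printing Implicit Defensive.

Local Open Scope classical_set_scope.
Local Open Scope group_scope.

Record category := Category {
  obj :> Type;
  hom : obj -> obj -> Type;
  idm : forall X, hom X X;
  comp : forall X Y Z, hom Y Z -> hom X Y -> hom X Z;
  comp1m : forall X Y (f : hom X Y), comp (idm Y) f = f;
  compm1 : forall X Y (f : hom X Y), comp f (idm X) = f;
  compA : forall W X Y Z (h : hom Y Z) (g : hom X Y) (f : hom W X),
    comp h (comp g f) = comp (comp h g) f }.

Arguments hom {_} _ _.
Arguments idm {_} _.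
Arguments comp {_ _ _ _} _ _.

Definition is_terminal (K : category) (T : K) : Prop :=
  forall X : K, exists! t : hom X T, True.

(** The square [comp i f = comp j g] is a pushout. *)
Definition is_pushout (K : category) (A B D P : K)
    (f : hom A B) (g : hom A D) (i : hom B P) (j : hom D P) : Prop :=
  comp i f = comp j g /\
  forall (Q : K) (u : hom B Q) (v : hom D Q), comp u f = comp v g ->
    exists! w : hom P Q, comp w i = u /\ comp w j = v.

(** The square [comp i h = comp j k] is a pullback. *)
Definition is_pullback (K : category) (B D P N : K)
    (i : hom B P) (j : hom D P) (h : hom N B) (k : hom N D) : Prop :=
  comp i h = comp j k /\
  forall (Q : K) (u : hom Q B) (v : hom Q D), comp i u = comp j v ->
    exists! w : hom Q N, comp h w = u /\ comp k w = v.

(** [nu : N -> B] is a normal closure of [f : A -> B]: the projection to [B] of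
    a pullback of the injections [B -> P <- T] of a pushout [P] of [f] along
    [A -> T], with [T] terminal.  As limits and colimits are only determined up
    to isomorphism, this is a predicate on [nu]; see [normal_closure_unique]. *)
Definition is_normal_closure (K : category) (A B N : K)
    (f : hom A B) (nu : hom N B) : Prop :=
  exists (T P : K) (t : hom A T) (i : hom B P) (j : hom T P) (s : hom N T),
    [/\ is_terminal T, is_pushout f t i j & is_pullback i j nu s].

Lemma terminal_eq (K : category) (T X : K) (s t : hom X T) :
  is_terminal T -> s = t.
Proof. by move=> /(_ X)[r [_ rU]]; rewrite -(rU s I) -(rU t I). Qed.

Lemma normal_closure_factor (K : category) (A B N N' : K)
    (f : hom A B) (nu : hom N B) (nu' : hom N' B) :
    is_normal_closure f nu -> is_normal_closure f nu' ->
  exists h : hom N' N, comp nu h = nu'.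
Proof.
move=> [T [P [t [i [j [s [TT [itjf _] [_ pbU]]]]]]]].
move=> [T' [P' [t' [i' [j' [s' [_ [_ poU] [pbE _]]]]]]]].
have [u _] := TT T'.
have [|w [[wi wj] _]] := poU P i (comp j u).
  by rewrite itjf -compA; congr comp; apply: terminal_eq.
have [|h [[hnu _] _]] := pbU N' nu' (comp u s'); last by exists h.
by rewrite -wi -compA pbE compA wj compA.
Qed.

Lemma normal_closure_mono (K : category) (A B N : K)
    (f : hom A B) (nu : hom N B) : is_normal_closure f nu ->
  forall (Q : K) (h k : hom Q N), comp nu h = comp nu k -> h = k.
Proof.
move=> [T [P [t [i [j [s [TT _ [pbE pbU]]]]]]]] Q h k hk.
have [|w [_ wU]] := pbU Q (comp nu h) (comp s h); first by rewrite !compA pbE.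
rewrite -(wU h) // -(wU k) //; split; first exact: esym.
exact: terminal_eq.
Qed.

Lemma normal_closure_unique (K : category) (A B N N' : K)
    (f : hom A B) (nu : hom N B) (nu' : hom N' B) :
    is_normal_closure f nu -> is_normal_closure f nu' ->
  exists (h : hom N' N) (k : hom N N'),
    [/\ comp h k = idm N, comp k h = idm N', comp nu h = nu' & comp nu' k = nu].
Proof.
move=> nuP nuP'; have [h hE] := normal_closure_factor nuP nuP'.
have [k kE] := normal_closure_factor nuP' nuP; exists h, k; split=> //.
  by apply: (normal_closure_mono nuP); rewrite compA hE kE compm1.
by apply: (normal_closure_mono nuP'); rewrite compA kE hE compm1.
Qed.

Record slice_obj (K : category) (X : K) := SliceObj {
  dom : K;
  str : hom dom X }.

Record slice_hom (K : category) (X : K) (q p : slice_obj X) := SliceHom {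
  mor : hom (dom q) (dom p);
  morE : comp (str p) mor = str q }.

Lemma slice_hom_eq (K : category) (X : K) (q p : slice_obj X)
  (f g : slice_hom q p) : mor f = mor g -> f = g.
Proof.
by case: f g => [f fE] [g gE] /= fg; subst g; rewrite (Prop_irrelevance fE gE).
Qed.

Definition slice_id (K : category) (X : K) (p : slice_obj X) : slice_hom p p :=
  SliceHom (compm1 (str p)).

Lemma slice_comp_subproof (K : category) (X : K) (r q p : slice_obj X)
    (g : slice_hom q p) (f : slice_hom r q) :
  comp (str p) (comp (mor g) (mor f)) = str r.
Proof. by rewrite compA !morE. Qed.

Definition slice_comp (K : category) (X : K) (r q p : slice_obj X)
    (g : slice_hom q p) (f : slice_hom r q) : slice_hom r p :=
  SliceHom (slice_comp_subproof g f).

Definition slice (K : category) (X : K) : category.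
Proof.
refine (@Category (slice_obj X) (@slice_hom K X) (@slice_id K X)
  (@slice_comp K X) _ _ _).
- by move=> p q f; apply/slice_hom_eq/comp1m.
- by move=> p q f; apply/slice_hom_eq/compm1.
- by move=> p q r s h g f; apply/slice_hom_eq/compA.
Defined.

(** [f], seen as a morphism [p f -> p] of the slice over [X]. *)
Definition to_slice (K : category) (X Y Z : K) (f : hom Z Y) (p : hom Y X) :
    @hom (slice X) (SliceObj (comp p f)) (SliceObj p) :=
  @SliceHom K X (SliceObj (comp p f)) (SliceObj p) f erefl.

Notation group_hom := UMagmaMorphism.type.

Lemma group_hom_eq (G H : groupType) (f g : group_hom G H) : f =1 g -> f = g.
Proof.
case: f g => [f [[f1] [fM]]] [g [[g1] [gM]]] /= /funext fg; subst g.
by rewrite (Prop_irrelevance f1 g1) (Prop_irrelevance fM gM).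
Qed.

Definition Grp : category.
Proof.
refine (@Category groupType (fun G H => group_hom G H) (fun G => idfun)
  (fun G H K g f => g \o f) _ _ _); by move=> *; apply: group_hom_eq.
Defined.

Definition is_normal_subgroup (G : groupType) (N : set G) : Prop :=
  group_closed (mem N) /\ forall x y, N x -> N (x ^ y).

Definition normal_hull (G : groupType) (E : set G) : set G :=
  smallest (@is_normal_subgroup G) E.

Definition gker (G H : groupType) (f : group_hom G H) : set G :=
  [set x | f x = 1].

(** [Im(f)] times the least normal subgroup of [B] containing
    [Ker(p) /\ Im(f)]. *)
Definition slice_closure_set (A B C : groupType)
    (f : group_hom A B) (p : group_hom B C) : set B :=
  [set x * y | x in range f & y in normal_hull (gker p `&` range f)].

Lemma normal_hull_normal (G : groupType) (E : set G) :
  is_normal_subgroup (normal_hull E).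
Proof.
split; first split.
- by rewrite inE => N [[[N1 _] _] _]; rewrite inE in N1.
- move=> x y; rewrite !inE => Ex Ey N NE; have [[[_ NB] _] _] := NE.
  by have := NB x y; rewrite !inE; apply; [apply: Ex | apply: Ey].
- by move=> x y Ex N NE; have [[_ NJ] _] := NE; exact: NJ (Ex N NE).
Qed.

Lemma slice_closure_group_closed (A B C : groupType)
    (f : group_hom A B) (p : group_hom B C) :
  group_closed (mem (slice_closure_set f p)).
Proof.
have [[E1 EB] EJ] := normal_hull_normal (gker p `&` range f).
rewrite inE in E1; split.
  by rewrite inE; exists 1; [exists 1; rewrite ?gmulf1|exists 1; rewrite ?mulg1].
move=> _ _ /set_mem[_ [a _ <-] [e Ee <-]] /set_mem[_ [a' _ <-] [e' Ee' <-]].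
rewrite inE; exists (f (a / a')); first by exists (a / a').
exists ((e / e') ^ (f a')^-1).
  by apply: EJ; have := EB e e'; rewrite !inE; apply.
rewrite gmulfF /conjg invgK invgM !mulgA.
by rewrite -[_ / f a' * f a']mulgA mulVg mulg1.
Qed.

Definition slice_closure (A B C : groupType)
    (f : group_hom A B) (p : group_hom B C) : Type :=
  {x : B | x \in slice_closure_set f p}.

HB.instance Definition _ (A B C : groupType)
    (f : group_hom A B) (p : group_hom B C) :=
  SubChoice.on (slice_closure f p).
HB.instance Definition _ (A B C : groupType)
    (f : group_hom A B) (p : group_hom B C) :=
  SubChoice_isSubGroup.Build B _ (slice_closure f p)
    (slice_closure_group_closed f p).

Definition slice_closure_incl (A B C : groupType)
    (f : group_hom A B) (p : group_hom B C) :
  group_hom (slice_closure f p) B := \val.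

(* Main.v *)
(** Let [i : B -> P] and [j : C -> P] be the injections of the pushout of [f] along
    [p f].  The map [P -> C] induced by [p] and the identity shows that [i b = j c]
    forces [c = p b], so the normal closure in the slice is [{b | i b = j (p b)}];
    it clearly contains [Im f] and the normal hull [N] of [Ker p /\ Im f].
    Conversely, it suffices to find a cocone in which [b] and [p b] have the same
    image only if [b] lies in [(Im f) N].  Since [p] is injective on [Im f]
    modulo [N], there is a map [g : C -> Im f] with [g (p h * x) = h * g x]
    modulo [N] for all [h] in [Im f].  In the wreath product of [B / N] by [C],
    the conjugate by [g] of [b |-> (const b, p b)] agrees on [Im f] with the
    inclusion of [C], and if [b] and [p b] have the same image there, then
    [b = g (p b) * (g 1)^-1] modulo [N]. *)

From HB Require Import structures.
Require Import Defs.
From mathcomp Require Import all_boot.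
From mathcomp Require Import boolp classical_sets.

Local Open Scope classical_set_scope.
Local Open Scope group_scope.

(* A group up to [gc_eqv].  The quotient computes inverses on representatives, so
   compatibility of [gc_inv] with [gc_eqv] is not required. *)
Record group_congruence := GroupCongruence {
  gc_sort : choiceType;
  gc_mul : gc_sort -> gc_sort -> gc_sort;
  gc_one : gc_sort;
  gc_inv : gc_sort -> gc_sort;
  gc_eqv : gc_sort -> gc_sort -> Prop;
  gc_mulA : associative gc_mul;
  gc_mul1m : left_id gc_one gc_mul;
  gc_mulm1 : right_id gc_one gc_mul;
  gc_refl : forall x, gc_eqv x x;
  gc_sym : forall x y, gc_eqv x y -> gc_eqv y x;
  gc_trans : forall x y z, gc_eqv x y -> gc_eqv y z -> gc_eqv x z;
  gc_mul_eqv : forall x x' y y',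
    gc_eqv x x' -> gc_eqv y y' -> gc_eqv (gc_mul x y) (gc_mul x' y');
  gc_mulVm : forall x, gc_eqv (gc_mul (gc_inv x) x) gc_one;
  gc_mulmV : forall x, gc_eqv (gc_mul x (gc_inv x)) gc_one }.

(** * Quotient groups by congruences *)

Section Quotient.
Variable M : group_congruence.
Local Open Scope quotient_scope.

Definition gc_rel : rel (gc_sort M) := fun x y => `[< gc_eqv M x y >].

Lemma gc_rel_refl : reflexive gc_rel.
Proof. by move=> x; apply/asboolP/gc_refl. Qed.

Lemma gc_rel_sym : symmetric gc_rel.
Proof. by move=> x y; apply/asboolP/asboolP; apply: gc_sym. Qed.

Lemma gc_rel_trans : transitive gc_rel.
Proof.
by move=> y x z /asboolP xy /asboolP yz; apply/asboolP/(gc_trans _ _ y).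
Qed.

Canonical gc_equiv := EquivRel gc_rel gc_rel_refl gc_rel_sym gc_rel_trans.

Definition gc_quot := {eq_quot gc_equiv}.
HB.instance Definition _ := Choice.on gc_quot.

Definition gc_pi (x : gc_sort M) : gc_quot := \pi_({eq_quot gc_equiv}) x.
Definition gc_repr (u : gc_quot) : gc_sort M := repr (u : {eq_quot gc_equiv}).

Lemma gc_reprK u : gc_pi (gc_repr u) = u.
Proof. exact: reprK. Qed.

Lemma gc_piP x y : gc_pi x = gc_pi y <-> gc_eqv M x y.
Proof. by split=> [/eqmodP/asboolP|xy] //; apply/eqmodP/asboolP. Qed.

Definition gc_quot_mul (u v : gc_quot) : gc_quot :=
  gc_pi (gc_mul M (gc_repr u) (gc_repr v)).
Definition gc_quot_inv (u : gc_quot) : gc_quot := gc_pi (gc_inv M (gc_repr u)).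

Lemma gc_pi_mul x y : gc_pi (gc_mul M x y) = gc_quot_mul (gc_pi x) (gc_pi y).
Proof. by apply/gc_piP/gc_mul_eqv; apply/gc_piP; rewrite gc_reprK. Qed.

Lemma gc_quot_mulA : associative gc_quot_mul.
Proof.
move=> u v w; rewrite -(gc_reprK u) -(gc_reprK v) -(gc_reprK w).
by rewrite -!gc_pi_mul gc_mulA.
Qed.

Lemma gc_quot_mul1 : left_id (gc_pi (gc_one M)) gc_quot_mul.
Proof. by move=> u; rewrite -(gc_reprK u) -gc_pi_mul gc_mul1m. Qed.

Lemma gc_quot_mulr1 : right_id (gc_pi (gc_one M)) gc_quot_mul.
Proof. by move=> u; rewrite -(gc_reprK u) -gc_pi_mul gc_mulm1. Qed.

Lemma gc_quot_mulV :
  left_inverse (gc_pi (gc_one M)) gc_quot_inv gc_quot_mul.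
Proof.
by move=> u; rewrite -{2}(gc_reprK u) -gc_pi_mul; apply/gc_piP/gc_mulVm.
Qed.

Lemma gc_quot_mulrV :
  right_inverse (gc_pi (gc_one M)) gc_quot_inv gc_quot_mul.
Proof.
by move=> u; rewrite -{1}(gc_reprK u) -gc_pi_mul; apply/gc_piP/gc_mulmV.
Qed.

HB.instance Definition _ := isGroup.Build gc_quot gc_quot_mulA gc_quot_mul1
  gc_quot_mulr1 gc_quot_mulV gc_quot_mulrV.

Lemma gc_piM x y : gc_pi (gc_mul M x y) = gc_pi x * gc_pi y.
Proof. exact: gc_pi_mul. Qed.

End Quotient.

Lemma group_hom_of (G H : groupType) (h : G -> H) :
  {morph h : x y / x * y} -> {h' : group_hom G H | h' =1 h}.
Proof.
move=> hM.
have h1 : h 1 = 1 by apply: (mulgI (h 1)); rewrite -hM !mulg1.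
pose hmix := isUMagmaMorphism.Build G H h (h1, hM).
by exists (HB.pack_for (group_hom G H) h hmix).
Qed.

(** The trivial group, used as the terminal object of [Grp] in the construction of $\nu_f$. *)
HB.instance Definition _ := @isGroup.Build unit tt id (fun _ _ => tt)
  (fun _ _ _ => erefl) (fun x => let: tt := x in erefl)
  (fun x => let: tt := x in erefl) (fun _ => erefl) (fun _ => erefl).

(** * Pushouts of groups, built from words *)

Section Pushout.
Variables (A B C : groupType) (f : group_hom A B) (g : group_hom A C).
Implicit Types w : seq (B + C).

Definition word_eval (Q : groupType) (u : B -> Q) (v : C -> Q) w : Q :=
  \prod_(z <- w) match z with inl b => u b | inr c => v c end.

Definition word_inv w : seq (B + C) :=
  rev [seq match z with inl b => inl b^-1 | inr c => inr c^-1 end | z <- w].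

(* Identifying the words with equal values in every competing cocone makes the
   universal property of the quotient immediate. *)
Definition word_eqv w w' : Prop :=
  forall (Q : groupType) (u : group_hom B Q) (v : group_hom C Q),
    u \o f =1 v \o g -> word_eval Q u v w = word_eval Q u v w'.

Lemma word_eval_cat (Q : groupType) (u : B -> Q) (v : C -> Q) w w' :
  word_eval Q u v (w ++ w') = word_eval Q u v w * word_eval Q u v w'.
Proof. exact: big_cat. Qed.

Lemma word_eval_inv (Q : groupType) (u : group_hom B Q) (v : group_hom C Q) w :
  word_eval Q u v (word_inv w) = (word_eval Q u v w)^-1.
Proof.
elim: w => [|z w IHw]; first by rewrite /word_eval !big_nil invg1.
rewrite /word_inv map_cons rev_cons -cats1 word_eval_cat -/(word_inv w) IHw.
by rewrite /word_eval big_seq1 big_cons invgM; case: z => x; rewrite gmulfV.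
Qed.

Definition pushout_congruence : group_congruence.
Proof.
refine (@GroupCongruence (seq (B + C)) cat [::] word_inv word_eqv
  (@catA _) (@cat0s _) (@cats0 _) _ _ _ _ _ _).
- by [].
- by move=> w w' ww' Q u v uv; rewrite ww'.
- by move=> w w' w'' ww' ww'' Q u v uv; rewrite ww' // ww''.
- move=> w1 w1' w2 w2' e1 e2 Q u v uv.
  by rewrite !word_eval_cat e1 // e2.
- move=> w Q u v uv.
  by rewrite word_eval_cat word_eval_inv mulVg /word_eval big_nil.
- move=> w Q u v uv.
  by rewrite word_eval_cat word_eval_inv mulgV /word_eval big_nil.
Defined.

(** The square commutes on classes of words because it does so in every cocone; each class is a
    product of classes of letters, which determines the mediating map. *)
Lemma grp_pushout_exists :
  exists (P : groupType) (i : group_hom B P) (j : group_hom C P),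
    @is_pushout Grp A B C P f g i j.
Proof.
pose P := gc_quot pushout_congruence.
pose cls : seq (B + C) -> P := gc_pi pushout_congruence.
have clsM w w' : cls (w ++ w') = cls w * cls w'.
  exact: (@gc_piM pushout_congruence w w').
have clsP w w' : cls w = cls w' <-> word_eqv w w'.
  exact: (@gc_piP pushout_congruence w w').
have [|i iE] := @group_hom_of B P (fun b => cls [:: inl b]).
  move=> b b'; rewrite -clsM; apply/clsP => Q u v uv.
  by rewrite /word_eval !big_cons !big_nil !mulg1 gmulfM.
have [|j jE] := @group_hom_of C P (fun c => cls [:: inr c]).
  move=> c c'; rewrite -clsM; apply/clsP => Q u v uv.
  by rewrite /word_eval !big_cons !big_nil !mulg1 gmulfM.
exists P, i, j; split=> [|Q u v uv].
  apply: group_hom_eq => a; rewrite /= iE jE; apply/clsP => Q u v uv.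
  by rewrite /word_eval !big_cons !big_nil !mulg1; apply: uv.
have {}uv : u \o f =1 v \o g.
  by move=> a; have := congr1 (fun h : group_hom A Q => h a) uv.
(* Evaluation on a chosen representative; [valE] shows that the choice does not matter. *)
pose val (x : P) : Q := word_eval Q u v (gc_repr pushout_congruence x).
have valE w : val (cls w) = word_eval Q u v w.
  by apply: ((clsP _ _).1 _ Q u v uv); apply: gc_reprK.
have [|h hE] := @group_hom_of P Q val.
  move=> x y; rewrite -(gc_reprK _ x) -(gc_reprK _ y).
  by rewrite -[LHS]/(val (cls _ * cls _)) -clsM !valE word_eval_cat.
exists h; split=> [|h' [h'i h'j]].
  split; apply: group_hom_eq => x /=; rewrite hE ?iE ?jE valE /word_eval;
    by rewrite big_seq1.
apply: group_hom_eq => x; rewrite hE -(gc_reprK _ x) -/cls valE.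
elim: (gc_repr _ x) => [|z w IHw].
  by rewrite /word_eval big_nil -[cls [::]]/(1 : P) gmulf1.
rewrite -cat1s clsM gmulfM -IHw word_eval_cat; congr (_ * _).
rewrite /word_eval big_seq1; case: z => y.
  by rewrite -iE -h'i.
by rewrite -jE -h'j.
Qed.

End Pushout.

(** * Normal subgroups and kernels *)

Section NormalSubgroup.
Variables (G : groupType) (N : set G).
Hypothesis nN : is_normal_subgroup N.

Lemma normal1 : N 1.
Proof. by have [[N1 _] _] := nN; rewrite inE in N1. Qed.

Lemma normalV x : N x -> N x^-1.
Proof.
have [[_ NF] _] := nN.
by move=> Nx; have := NF 1 x; rewrite !inE div1g; apply; first exact: normal1.
Qed.

Lemma normalM x y : N x -> N y -> N (x * y).
Proof.
have [[_ NF] _] := nN.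
move=> Nx /normalV Ny; have := NF x y^-1; rewrite !inE invgK; exact.
Qed.

Lemma normalJ x y : N x -> N (x ^ y).
Proof. by have [_] := nN; apply. Qed.

Lemma normalC x y : N (x * y) -> N (y * x).
Proof. by move=> /(normalJ _ x); rewrite /conjg -mulgA mulKg. Qed.

End NormalSubgroup.

Arguments normal1 {G N}.
Arguments normalV {G N} _ [x].
Arguments normalM {G N} _ [x y].
Arguments normalJ {G N} _ [x].
Arguments normalC {G N} _ [x y].

Lemma gker_normal {G H : groupType} (h : group_hom G H) :
  is_normal_subgroup (gker h).
Proof.
split; first split; first by rewrite inE /gker /= gmulf1.
  move=> x y /set_mem hx /set_mem hy; rewrite inE /gker /= gmulfF.
  by rewrite hx hy divg1.
by move=> x y hx; rewrite /gker /= gmulfJ hx conj1g.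
Qed.

Lemma normal_hull_sub {G : groupType} (E N : set G) :
  is_normal_subgroup N -> E `<=` N -> normal_hull E `<=` N.
Proof. by move=> nN EN x; apply. Qed.

(** * Wreath products modulo a normal subgroup *)

Section Wreath.
Variables (B C : groupType) (N : set B).
Hypothesis nN : is_normal_subgroup N.

(* The unrestricted wreath product of [B] by [C], with base taken modulo [N]. *)
Definition wreath_congruence : group_congruence.
Proof.
refine (@GroupCongruence (((C -> B) * C)%type : choiceType)
  (fun s t => (fun x => s.1 x * t.1 (s.2^-1 * x), s.2 * t.2))
  (fun=> 1, 1)
  (fun s => (fun x => (s.1 (s.2 * x))^-1, s.2^-1))
  (fun s t => s.2 = t.2 /\ forall x, N ((s.1 x)^-1 * t.1 x))
  _ _ _ _ _ _ _ _ _).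
- move=> s t r /=; rewrite mulgA; congr pair; apply/funext => x.
  by rewrite mulgA invgM mulgA.
- case=> s c /=; rewrite mul1g; congr pair; apply/funext => x.
  by rewrite invg1 !mul1g.
- by case=> s c /=; rewrite mulg1; congr pair; apply/funext => x; rewrite mulg1.
- by move=> s; split=> // x; rewrite mulVg; apply: (normal1 nN).
- move=> s t [e st]; split=> // x.
  by have := normalV nN (st x); rewrite invgM invgK.
- move=> s t r [-> st] [-> tr]; split=> // x.
  by have := normalM nN (st x) (tr x); rewrite mulgA mulgK.
- move=> s s' t t' [/= -> ss'] [/= -> tt']; split=> //= x.
  (* Pointwise, $(st)^{-1}s't'=(s^{-1}s')^t\,(t^{-1}t')$, and normality absorbs the conjugation. *)
  have := normalM nN
    (normalJ nN (t.1 (s'.2^-1 * x)) (ss' x)) (tt' (s'.2^-1 * x)).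
  by rewrite /conjg invgM !mulgA mulgK.
- move=> s; split=> /= [|x]; first by rewrite mulVg.
  by rewrite invgK mulVg invg1 mul1g; apply: (normal1 nN).
- move=> s; split=> /= [|x]; first by rewrite mulgV.
  by rewrite mulVKg mulgV invg1 mul1g; apply: (normal1 nN).
Defined.

End Wreath.

(** Choose [r x] in the coset $\mathrm{Im}(q)\,x$, and let [t x] witness the choice. *)
Lemma coset_representatives {A C : groupType} (q : group_hom A C) :
  exists (r : C -> C) (t : C -> A),
    (forall a x, r (q a * x) = r x) /\ (forall x, x = q (t x) * r x).
Proof.
pose S (x : C) : set C := [set y | exists a, x = q a * y].
have SM a x : S (q a * x) = S x.
  rewrite eqEsubset; split=> y [a' e].
    by exists (a^-1 * a'); rewrite gmulfM -mulgA -e gmulfV mulKg.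
  by exists (a * a'); rewrite e gmulfM mulgA.
(* The choice depends on the set [S x] only, so equal cosets get equal representatives; the default
   1 never occurs, as [x] lies in [S x]. *)
pose r x := xget 1 (S x).
have rS x : S x (r x) by apply: xgetPex; exists x, 1; rewrite gmulf1 mul1g.
have [t tE] := choice rS; exists r, t; split=> // a x.
by rewrite /r SM.
Qed.

(** * The separating cocone *)

Section Separation.
Variables (A B C : groupType) (f : group_hom A B) (p : group_hom B C).

Let E : set B := gker p `&` range f.
Let N := normal_hull E.
Let nN : is_normal_subgroup N := normal_hull_normal E.

Lemma slice_closure_separation (b : B) (c : C) :
  (forall (Q : groupType) (u : group_hom B Q) (v : group_hom C Q),
     u \o f =1 v \o (p \o f) -> u b = v c) ->
  slice_closure_set f p b.
Proof.
move=> uvbc.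
have [r [t [rM tE]]] := coset_representatives (p \o f).
pose g x := f (t x).
(* Both [f a * g x] and [g (p (f a) * x)] lie in $\mathrm{Im}(f)$, and [p] agrees on them because
   [r] is constant on cosets; so they differ by an element of [E]. *)
have gM a x : N ((f a * g x)^-1 * g (p (f a) * x)).
  move=> M [nM]; apply; split; last first.
    by exists ((a * t x)^-1 * t (p (f a) * x)); rewrite ?gmulfM ?gmulfV ?gmulfM.
  rewrite /gker /= gmulfM gmulfV gmulfM.
  have e : p (f a) * p (f (t x)) * r x = p (f (t (p (f a) * x))) * r x.
    by rewrite -mulgA -[p (f (t x)) * r x]tE -(rM a x) -[RHS]tE.
  by apply: (mulIg (r x)); rewrite mul1g -mulgA -e mulKg.
pose W := wreath_congruence B C N nN.
have WM s s' :
    gc_mul W s s' = (fun x => s.1 x * s'.1 (s.2^-1 * x), s.2 * s'.2) by [].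
have [|u uE] := @group_hom_of B (gc_quot W)
    (fun b => gc_pi W (fun x => (g x)^-1 * b * g ((p b)^-1 * x), p b)).
  (* The inner values of [g] cancel exactly, before passing to classes. *)
  move=> x y; rewrite -gc_piM WM /= gmulfM; congr gc_pi; congr pair.
  by apply/funext => z; rewrite !mulgA mulgK invgM.
have [|v vE] := @group_hom_of C (gc_quot W) (fun c => gc_pi W (fun=> 1, c)).
  move=> x y; rewrite -gc_piM WM; congr gc_pi; congr pair.
  by apply/funext => z; rewrite mulg1.
have uv : u \o f =1 v \o (p \o f).
  move=> a; rewrite /= uE vE; apply/gc_piP; split=> //= x.
  have := gM a ((p (f a))^-1 * x).
  by rewrite mulVKg mulg1 -mulgA [in X in _ -> X]invgM invgK.
(* At the point [p b] the last factor becomes [g 1], giving $g(pb)^{-1}\,b\,g(1)\in N$. A cyclic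
   rotation then isolates [b]; [g 1] itself may be nontrivial. *)
have := uvbc _ u v uv; rewrite uE vE => /gc_piP[_ /= /(_ (p b))].
rewrite mulVg mulg1 => /(normalV nN); rewrite invgK => /(normalC nN).
move=> Nb; exists (f (t (p b) / t 1)); first by exists (t (p b) / t 1).
exists (g 1 * ((g (p b))^-1 * b)) => //.
by rewrite gmulfF !mulgA mulgVK mulgV mul1g.
Qed.
End Separation.

(** * Normal closures in a slice *)

(** The terminal object of the slice is the identity of [C], and [P] lies over [C] by the map
    induced by [p] and this identity. Pushout and pullback in the slice are then those of [K]. *)
Lemma slice_normal_closure (K : category) (A B C N P : K)
    (f : hom A B) (p : hom B C) (nu : hom N B) (i : hom B P) (j : hom C P) :
    is_pushout f (Defs.comp p f) i j -> is_pullback i j nu (Defs.comp p nu) ->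
  is_normal_closure (to_slice f p) (to_slice nu p).
Proof.
move=> [ijf poU] [ijnu pbU].
have [|w [[wi wj] _]] := poU C p (idm C); first by rewrite comp1m.
have str_mor (X Y : slice C) (h : hom X Y) : Defs.comp (str Y) (mor h) = str X.
  exact: morE.
have mor_congr (X Y : slice C) (h h' : hom X Y) : h = h' -> mor h = mor h'.
  by move=> ->.
pose T : slice C := SliceObj (idm C); pose P' : slice C := SliceObj w.
pose t (X : slice C) : hom X T := @SliceHom K C X T (str X) (comp1m (str X)).
have tU (X : slice C) (h : hom X T) : h = t X.
  by apply: slice_hom_eq; rewrite /= -(str_mor _ _ h) comp1m.
pose pB : slice C := SliceObj p.
pose i' : hom pB P' := @SliceHom K C pB P' i wi.
pose j' : hom T P' := @SliceHom K C T P' j wj.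
exists T, P', (t _), i', j', (t _); split.
- by move=> X; exists (t X); split=> // h _; rewrite (tU X h).
- split=> [|Q u v uv]; first exact: slice_hom_eq.
  have [|h [[hi hj] hU]] := poU _ (mor u) (mor v).
    exact: mor_congr _ _ _ _ uv.
  have [k [[ki kj] kU]] := poU C p (idm C) (esym (comp1m _)).
  (* Both maps restrict to [p] and the identity along [i] and [j], so uniqueness in the pushout
     makes [h] a morphism over [C]. *)
  have hw : Defs.comp (str Q) h = w.
    rewrite -(kU w) // -(kU (Defs.comp (str Q) h)) // -!Defs.compA hi hj.
    by split; [exact: (str_mor _ _ u) | exact: (str_mor _ _ v)].
  exists (@SliceHom K C P' Q h hw); split.
    by split; apply: slice_hom_eq.
  by move=> h' [h'i h'j]; apply: slice_hom_eq; apply: hU; split;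
    [exact: mor_congr _ _ _ _ h'i | exact: mor_congr _ _ _ _ h'j].
- split=> [|Q u v uv]; first exact: slice_hom_eq.
  have [|h [[hnu hs] hU]] := pbU _ (mor u) (mor v).
    exact: mor_congr _ _ _ _ uv.
  have hw : Defs.comp (Defs.comp p nu) h = str Q.
    by rewrite -Defs.compA hnu; exact: (str_mor _ _ u).
  exists (@SliceHom K C Q (SliceObj (Defs.comp p nu)) h hw); split.
    by split; apply: slice_hom_eq.
  by move=> h' [h'nu h's]; apply: slice_hom_eq; apply: hU; split;
    [exact: mor_congr _ _ _ _ h'nu | exact: mor_congr _ _ _ _ h's].
Qed.

(** * The pullback in groups, and the theorem *)

(** Keeping [nu] abstract, known only by its range, allows a second use with [p] replaced by the map
    to the trivial group. *)
Lemma grp_pullback_slice_closure (A B C N P : groupType)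
    (f : group_hom A B) (p : group_hom B C) (nu : group_hom N B)
    (i : group_hom B P) (j : group_hom C P) :
    injective nu -> range nu = slice_closure_set f p ->
    @is_pushout Grp A B C P f (p \o f) i j ->
  @is_pullback Grp B C P N i j nu (p \o nu).
Proof.
move=> nuI nuE [ijf poU].
have {}ijf a : i (f a) = j (p (f a)).
  by have := congr1 (fun h : group_hom A P => h a) ijf.
have ijP b c : i b = j c <-> c = p b /\ slice_closure_set f p b.
  split=> [ijbc|[-> [_ [a _ <-] [e eN <-]]]].
    (* Every cocone factors through [P], hence also identifies [b] and [c]; the cocone of [p] and
       [idfun] then yields [c = p b]. *)
    have uvbc (Q : groupType) (u : group_hom B Q) (v : group_hom C Q) :
      u \o f =1 v \o (p \o f) -> u b = v c.
      move=> uv; have [|w [[<- <-] _]] := poU Q u v; first exact: group_hom_eq.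
      by rewrite /= ijbc.
    split; last exact: slice_closure_separation uvbc.
    exact/esym/(uvbc C p idfun).
  have pe : gker p e.
    by apply: normal_hull_sub eN; [exact: gker_normal | move=> x []].
  (* On a generator $x=f(a')$ with $p(x)=1$, the square gives $i(x)=j(p(x))=1$. *)
  have ie : gker i e.
    apply: normal_hull_sub eN => [|x [px [a' _ a'x]]]; first exact: gker_normal.
    by rewrite /gker /= -a'x ijf a'x px gmulf1.
  by rewrite !gmulfM pe ie !gmulf1 !mulg1 ijf.
split=> [|Q u v uv].
  by apply: group_hom_eq => x; apply/ijP; split=> //; rewrite -nuE; exists x.
have {}uv x : i (u x) = j (v x).
  by have := congr1 (fun h : group_hom Q P => h x) uv.
have [h hE] : {h : Q -> N & forall x, nu (h x) = u x}.
  apply: (@choice _ _ (fun x y => nu y = u x)) => x.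
  have [_] := (ijP _ _).1 (uv x); rewrite -nuE => -[y _ <-].
  by exists y.
have [|h' h'E] := @group_hom_of Q N h.
  (* Injectivity of [nu] makes the chosen lifts multiplicative. *)
  by move=> x y; apply: nuI; rewrite gmulfM !hE gmulfM.
exists h'; split.
  split; apply: group_hom_eq => x /=; rewrite h'E hE //.
  by have [] := (ijP _ _).1 (uv x).
move=> k [ku _]; apply: group_hom_eq => x; apply: nuI.
by rewrite h'E hE -ku.
Qed.

Lemma slice_closure_incl_range (A B C : groupType)
    (f : group_hom A B) (p : group_hom B C) :
  range (slice_closure_incl f p) = slice_closure_set f p.
Proof.
rewrite eqEsubset; split=> [_ [x _ <-]|x fpx].
  exact/set_mem/(valP (x : {x | x \in slice_closure_set f p})).
by exists (exist _ x (mem_set fpx)).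
Qed.

Theorem theorem8p2 (A B C : groupType)
    (f : group_hom A B) (p : group_hom B C) :
  @is_normal_closure (@slice Grp C) _ _ _
    (@to_slice Grp C B A f p)
    (@to_slice Grp C B (slice_closure f p) (slice_closure_incl f p) p)
  /\ (range f `<=` gker p ->
      @is_normal_closure Grp A B (slice_closure f p)
        f (slice_closure_incl f p)).
Proof.
have inclI : injective (slice_closure_incl f p) by exact: val_inj.
have inclE := slice_closure_incl_range A B C f p.
split=> [|fp].
  have [P [i [j po]]] := grp_pushout_exists A B C f (p \o f).
  apply: (@slice_normal_closure Grp A B C _ P f p _ i j po).
  exact: (grp_pullback_slice_closure _ _ _ _ _ f p).
(* The normal closure in [Grp] is the case where [C] is trivial and [p] is [p0]. *)
have [|p0 _] := @group_hom_of B unit (fun=> 1); first by move=> *; rewrite mulg1.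
have [P [i [j po]]] := grp_pushout_exists A B unit f (p0 \o f).
pose T : Grp := (unit : groupType).
exists T, P, (@Defs.comp Grp A B T p0 f), i, j.
exists (@Defs.comp Grp _ B T p0 (slice_closure_incl f p)); split=> //.
  move=> X; have [|t _] := @group_hom_of X unit (fun=> 1).
    by move=> *; rewrite mulg1.
  exists t; split=> // t' _; apply: group_hom_eq => x.
  by case: (t x); case: (t' x).
apply: grp_pullback_slice_closure po => //; rewrite inclE.
(* Both kernels contain $\mathrm{Im}(f)$, so [p0] and [p] define the same subgroup. *)
have EE : gker p0 `&` range f = gker p `&` range f.
  rewrite [RHS]setIidr // setIidr // => x _.
  by rewrite /gker /=; case: (p0 x).
by rewrite /slice_closure_set EE.
Qed.
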